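(* Let $W$ be a finite-dimensional complex vector space and let $d,\delta$ be positive integers. The Foulkes-Howe map ${}^{W}\mathcal{F}^{\delta}_{(1)^d}:S^\delta(S^dW)\to S^d(S^\delta W)$ is self-dual, in the sense that for all $Q\in S^d(S^\delta W^* )$, $$\big({}^{W}\mathcal{F}^{\delta}_{(1)^d}\big)^T(Q)={}^{W^*}\mathcal{F}^{d}_{(1)^\delta}(Q).$$
   Context: For a vector space $A$, the Foulkes-Howe map ${}^{A}\mathcal{F}^{\delta}_{(1)^d}:S^\delta(S^dA)\to S^d(S^\delta A)$ is defined as follows: include $S^\delta(S^dA)\subset A^{\otimes\delta d}$ and label the tensor factors $(A_{1,1}\otimes\cdots\otimes A_{1,d})\otimes\cdots\otimes(A_{\delta,1}\otimes\cdots\otimes A_{\delta,d})$, all $A_{i,j}$ being copies of $A$; regroup as $(A_{1,1}\otimes\cdots\otimes A_{\delta,1})\otimes\cdots\otimes(A_{1,d}\otimes\cdots\otimes A_{\delta,d})$; symmetrize (by averaging over permutations) each of the $d$ groups of $\delta$ factors, and then symmetrize the ordering of the $d$ groups, to get an element of $S^d(S^\delta A)$. Thus ${}^{W^*}\mathcal{F}^{d}_{(1)^\delta}$ is a map $S^d(S^\delta W^* )\to S^\delta(S^dW^* )$. For a linear map $f:A\to B$, $f^T:B^*\to A^*$ denotes its transpose. The duals are identified as $(S^d(S^\delta W))^*=S^d(S^\delta W^* )$ and $(S^\delta(S^dW))^*=S^\delta(S^dW^* )$ via the pairings induced by polarization, i.e. by restricting the natural pairing of tensor powers of $W$ and $W^*$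 to symmetric tensors, so that e.g. $\langle x_1\cdots x_k,\alpha^k\rangle=\alpha(x_1)\cdots\alpha(x_k)$. *)

(* Defs.v *)
From HB Require Import structures.
From mathcomp Require Import all_boot all_order all_algebra all_fingroup.
From mathcomp Require Import boolp reals complex.

Set Implicit Arguments.
Unset Strict Implicit.
Unset Printing Implicit Defensive.

Import GRing.Theory Num.Theory.
Local Open Scope ring_scope.

Definition dual (K : fieldType) (V : vectType K) : vectType K := 'Hom(V, K^o).

Definition transpose (K : fieldType) (A B : vectType K) (f : 'Hom(A, B)) :
    'Hom(dual B, dual A) :=
  linfun (fun phi : dual B => (phi \o f)%VF : dual A).

Section TensorPower.
Variable K : fieldType.
Implicit Types (I J : finType) (U V : vectType K).

(* The tensor power of V with factors labelled by I, modelled by coordinate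
   arrays in the chosen basis of V.  The universal property (tens_multilinear,
   tlift_tens, tlift_uniq) shows that (tpow I V, tens) is the tensor power; everything below
   except tflat is defined by its values on the decomposable tensors tens v. *)
Definition tpow I V : vectType K :=
  {ffun {ffun I -> 'I_(\dim {:V})} -> K^o}.

Definition tcoef I V (t : tpow I V) (g : {ffun I -> 'I_(\dim {:V})}) : K :=
  (t : {ffun {ffun I -> 'I_(\dim {:V})} -> K^o}) g.

Definition mktpow I V (F : {ffun I -> 'I_(\dim {:V})} -> K) : tpow I V :=
  [ffun g => F g : K^o].

Definition tens I V (v : I -> V) : tpow I V :=
  mktpow (fun g => \prod_i coord (vbasis {:V}) (g i) (v i)).

Definition tlift I V U (f : (I -> V) -> U) : 'Hom(tpow I V, U) :=
  linfun (fun t : tpow I V =>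
    \sum_(g : {ffun I -> 'I_(\dim {:V})})
      tcoef t g *: f (fun i => (vbasis {:V})`_(g i))).

(* dfwith v x is the family v with its i-th member replaced by x. *)
Definition multilinear I V U (f : (I -> V) -> U) : Prop :=
  forall (v : I -> V) (i : I) (a : K) (x y : V),
    f (dfwith v (i := i) (a *: x + y)) =
    a *: f (dfwith v (i := i) x) + f (dfwith v (i := i) y).

Definition tmap I V U (f : 'Hom(V, U)) : 'Hom(tpow I V, tpow I U) :=
  tlift (fun v : I -> V => tens (fun i => f (v i))).

Definition treindex I J V (s : J -> I) : 'Hom(tpow I V, tpow J V) :=
  tlift (fun v : I -> V => tens (fun j => v (s j))).

Definition tsplit I J V : 'Hom(tpow (I * J)%type V, tpow I (tpow J V)) :=
  tlift (fun v : I * J -> V => tens (fun i => tens (fun j => v (i, j)))).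

(* The inverse of tsplit: see tflat_tens. *)
Definition tflat I J V : 'Hom(tpow I (tpow J V), tpow (I * J)%type V) :=
  tlift (fun u : I -> tpow J V =>
    mktpow (fun h => \prod_i tcoef (u i) [ffun j => h (i, j)])).

Definition tdual I V : 'Hom(tpow I (dual V), dual (tpow I V)) :=
  tlift (fun alpha : I -> dual V =>
    (tlift (fun v : I -> V => (\prod_i alpha i (v i) : K^o)) : dual (tpow I V))).

Definition symv (k : nat) V : {vspace tpow 'I_k V} :=
  (\bigcap_(s : 'S_k) fixedSpace (treindex V s))%VS.

(* S^k V, as the space of symmetric tensors in the k-th tensor power. *)
Definition Sym (k : nat) V : vectType K := subvs_of (symv k V).

Definition taverage (k : nat) V : 'End(tpow 'I_k V) :=
  (k`!%:R)^-1 *: \sum_(s : 'S_k) treindex V s.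

(* In characteristic 0 the average is symmetric (see vsval_symmetrize), so
   vsproj only changes its type. *)
Definition symmetrize (k : nat) V : 'Hom(tpow 'I_k V, Sym k V) :=
  (linfun (vsproj (symv k V)) \o taverage k V)%VF.

(* The inclusion of S^a (S^b V) in the tensor power of V with a * b factors,
   labelled by (group, position in the group). *)
Definition incl2 (a b : nat) V :
    'Hom(Sym a (Sym b V), tpow ('I_a * 'I_b)%type V) :=
  (tflat 'I_a 'I_b V \o (tmap 'I_a (linfun vsval) \o linfun vsval))%VF.

Definition foulkes_howe (delta d : nat) V :
    'Hom(Sym delta (Sym d V), Sym d (Sym delta V)) :=
  (symmetrize d (Sym delta V)
   \o (tmap 'I_d (symmetrize delta V)
   \o (tsplit 'I_d 'I_delta V
   \o (treindex V (fun p : 'I_d * 'I_delta => (p.2, p.1))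
   \o incl2 delta d V))))%VF.

(* The identification of S^a (S^b V^* ) with the dual of S^a (S^b V): Q is sent
   to the restriction to S^a (S^b V) of the natural pairing with Q.  It is an
   isomorphism in characteristic 0, see sym2_dual_bij. *)
Definition sym2_dual (a b : nat) V :
    'Hom(Sym a (Sym b (dual V)), dual (Sym a (Sym b V))) :=
  (transpose (incl2 a b V) \o
     (tdual ('I_a * 'I_b)%type V \o incl2 a b (dual V)))%VF.

(* Universal property of tpow *)

Lemma linfunE U V (f : U -> V) : linear f -> linfun f =1 f.
Proof.
move=> fl u; pose m := GRing.isLinear.Build K U V *:%R f fl.
pose F : {linear U -> V} := HB.pack f m.
exact: (lfunE F u).
Qed.

Lemma transposeE (A B : vectType K) (f : 'Hom(A, B)) (phi : dual B) (x : A) :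
  (transpose f phi : 'Hom(A, K^o)) x = (phi : 'Hom(B, K^o)) (f x).
Proof.
rewrite /transpose linfunE ?comp_lfunE// => a u v; apply/lfunP => y.
by do !rewrite lfunE /=.
Qed.

Lemma mktpowE I V F g : tcoef (@mktpow I V F) g = F g.
Proof. by rewrite /tcoef ffunE. Qed.

Lemma tpowP I V (s t : tpow I V) : tcoef s =1 tcoef t -> s = t.
Proof. by move=> e; apply/ffunP=> g; exact: (e g). Qed.

Lemma tcoefD I V a (s t : tpow I V) g :
  tcoef (a *: s + t) g = a * tcoef s g + tcoef t g.
Proof. by rewrite /tcoef !ffunE. Qed.

Lemma tcoef_sum I V (T : finType) (F : T -> tpow I V) g :
  tcoef (\sum_i F i) g = \sum_i tcoef (F i) g.
Proof. by rewrite /tcoef sum_ffunE. Qed.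

Lemma tcoefZ I V a (s : tpow I V) g : tcoef (a *: s) g = a * tcoef s g.
Proof. by rewrite /tcoef !ffunE. Qed.

Lemma tensE I V (v : I -> V) g :
  tcoef (tens v) g = \prod_i coord (vbasis {:V}) (g i) (v i).
Proof. exact: mktpowE. Qed.

Lemma tliftE I V U (f : (I -> V) -> U) t :
  tlift f t = \sum_(g : {ffun I -> 'I_(\dim {:V})})
      tcoef t g *: f (fun i => (vbasis {:V})`_(g i)).
Proof.
rewrite /tlift linfunE// => a x y.
rewrite scaler_sumr -big_split; apply: eq_bigr => g _.
by rewrite tcoefD scalerDl scalerA.
Qed.

Lemma coord_e V (k l : 'I_(\dim {:V})) :
  coord (vbasis {:V}) k (vbasis {:V})`_l = (k == l)%:R.
Proof.
by rewrite coord_free 1?eq_sym//; exact: basis_free (vbasisP _).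
Qed.

Lemma tens_basis I V (h g : {ffun I -> 'I_(\dim {:V})}) :
  tcoef (tens (fun i => (vbasis {:V})`_(h i))) g = (g == h)%:R.
Proof.
rewrite tensE; case: eqP => [->|/eqP ne].
  by apply: big1 => i _; rewrite coord_e eqxx.
have [i nei] : exists i, g i != h i.
  apply/existsP; apply: contraNT ne; rewrite negb_exists => /forallP e.
  by apply/eqP/ffunP => i; apply/eqP; have := e i; rewrite negbK.
by rewrite (bigD1 i)//= coord_e (negbTE nei) mul0r.
Qed.

Lemma tlift_basis I V U (f : (I -> V) -> U) (h : {ffun I -> 'I_(\dim {:V})}) :
  tlift f (tens (fun i => (vbasis {:V})`_(h i))) =
  f (fun i => (vbasis {:V})`_(h i)).
Proof.
rewrite tliftE (bigD1 h)//= tens_basis eqxx scale1r big1 ?addr0// => g ne.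
by rewrite tens_basis (negbTE ne) scale0r.
Qed.

Lemma dfwith_id I V (v : I -> V) i : dfwith v (i := i) (v i) = v.
Proof. by apply/funext => j; case: dfwithP. Qed.

Lemma multilinear_sum I V U (f : (I -> V) -> U) : multilinear f ->
  forall v i (T : finType) (c : T -> K) (x : T -> V),
  f (dfwith v (i := i) (\sum_k c k *: x k)) =
  \sum_k c k *: f (dfwith v (i := i) (x k)).
Proof.
move=> fm v i T c x.
have f0 : f (dfwith v (i := i) 0) = 0.
  by have := fm v i (-1) 0 0; rewrite scaler0 addr0 scaleN1r addNr.
elim/big_rec2: _ => // k y1 y2 _ <-.
by rewrite fm.
Qed.

Lemma multilinear_ext I V U (f f' : (I -> V) -> U) :
  multilinear f -> multilinear f' ->
  (forall g : {ffun I -> 'I_(\dim {:V})},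
     f (fun i => (vbasis {:V})`_(g i)) = f' (fun i => (vbasis {:V})`_(g i))) ->
  f =1 f'.
Proof.
move=> fm f'm e v.
have H (s : seq I) (w : I -> V) :
    (forall i, i \notin s -> exists k : 'I_(\dim {:V}), w i = (vbasis {:V})`_k) ->
    f w = f' w.
  elim: s w => [|i s IH] w hw.
    have /choice[g hg] : forall i, exists k : 'I_(\dim {:V}), w i = (vbasis {:V})`_k.
      by move=> i; exact: hw.
    have := e (finfun g); suff -> : (fun i => (vbasis {:V})`_(finfun g i)) = w by [].
    by apply/funext => i; rewrite ffunE hg.
  rewrite -(dfwith_id w i) (coord_vbasis (memvf (w i))).
  rewrite !multilinear_sum//; apply: eq_bigr => k _; congr (_ *: _).
  apply: IH => j; case: dfwithP => [|j' ne] js; first by exists k.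
  by apply: hw; rewrite in_cons negb_or eq_sym ne js.
by apply: (H (enum I)) => i; rewrite mem_enum.
Qed.

Lemma prod_multilinear I V (c : I -> 'Hom(V, K^o)) :
  multilinear (fun v : I -> V => (\prod_i c i (v i) : K^o)).
Proof.
move=> v i a x y.
rewrite !(bigD1 i (P := xpredT))//= !dfwith_in linearP mulrDl -scalerAl.
by congr (_ *: (_ * _) + _ * _); apply: eq_bigr => j ne;
  rewrite !dfwith_out// eq_sym.
Qed.

Lemma mktpow_multilinear I V J U
    (c : {ffun J -> 'I_(\dim {:U})} -> I -> 'Hom(V, K^o)) :
  multilinear (fun v : I -> V => mktpow (fun g => \prod_i c g i (v i)) : tpow J U).
Proof.
move=> v i a x y; apply: tpowP => g.
by rewrite tcoefD !mktpowE (prod_multilinear (c g)).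
Qed.

Lemma tens_multilinear I V : multilinear (@tens I V).
Proof.
move=> v i a x y; apply: tpowP => g; rewrite tcoefD !tensE.
pose c i := linfun (coord (vbasis {:V}) (g i) : V -> K^o).
have cE w : \prod_i coord (vbasis {:V}) (g i) (w i) = \prod_i c i (w i).
  by apply: eq_bigr => j _; rewrite lfunE.
by rewrite !cE (prod_multilinear c).
Qed.

Lemma comp_multilinear I V U U' (f : (I -> V) -> U) (F : 'Hom(U, U')) :
  multilinear f -> multilinear (F \o f).
Proof. by move=> fm v i a x y; rewrite /= fm linearP. Qed.

Lemma pre_multilinear I V V' U (f : (I -> V') -> U) (F : I -> 'Hom(V, V')) :
  multilinear f -> multilinear (fun v => f (fun i => F i (v i))).
Proof.
move=> fm v i a x y.
have E z : (fun j => F j (dfwith v (i := i) z j)) =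
           dfwith (fun j => F j (v j)) (i := i) (F i z).
  by apply/funext => j; case: dfwithP => [|k ne];
    rewrite ?dfwith_in// dfwith_out.
by rewrite !E linearP fm.
Qed.

Lemma tlift_tens I V U (f : (I -> V) -> U) : multilinear f ->
  forall v, tlift f (tens v) = f v.
Proof.
move=> fm; apply: (@multilinear_ext _ _ _ (tlift f \o @tens I V)) => //=.
  by apply: comp_multilinear; exact: tens_multilinear.
by move=> g; exact: tlift_basis.
Qed.

Lemma tlift_uniq I V U (F G : 'Hom(tpow I V, U)) :
  (forall v, F (tens v) = G (tens v)) -> F = G.
Proof.
move=> e; apply/lfunP => t.
have -> : t = \sum_g tcoef t g *: tens (fun i => (vbasis {:V})`_(g i)).
  apply: tpowP => h; rewrite tcoef_sum (bigD1 h)//= tcoefZ tens_basis eqxx.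
  rewrite mulr1 big1 ?addr0// => g ne.
  by rewrite tcoefZ tens_basis eq_sym (negbTE ne) mulr0.
by rewrite !linear_sum; apply: eq_bigr => g _; rewrite !linearZ/= e.
Qed.

(* Values on decomposable tensors *)

Lemma tmap_tens I V U (f : 'Hom(V, U)) (v : I -> V) :
  tmap I f (tens v) = tens (fun i => f (v i)).
Proof.
by rewrite tlift_tens//; apply: pre_multilinear; exact: tens_multilinear.
Qed.

Lemma treindex_tens I J V (s : J -> I) (v : I -> V) : bijective s ->
  treindex V s (tens v) = tens (fun j => v (s j)).
Proof.
move=> [s' sK s'K]; rewrite tlift_tens// => w i a x y.
have E z : (fun j => dfwith w (i := i) z (s j)) =
           dfwith (fun j => w (s j)) (i := s' i) z.
  apply/funext => j; have [<-|ne] := eqVneq (s' i) j.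
    by rewrite dfwith_in s'K dfwith_in.
  rewrite !dfwith_out//; apply: contraNneq ne => ->.
  by rewrite sK.
by rewrite !E tens_multilinear.
Qed.

Lemma tsplit_tens I J V (v : I * J -> V) :
  tsplit I J V (tens v) = tens (fun i => tens (fun j => v (i, j))).
Proof.
rewrite tlift_tens// => w [i0 j0] a x y.
have E z : (fun i => tens (fun j => dfwith w (i := (i0, j0)) z (i, j))) =
   dfwith (fun i => tens (fun j => w (i, j))) (i := i0)
     (tens (dfwith (fun j => w (i0, j)) (i := j0) z)).
  apply/funext => i; have [<-|ne] := eqVneq i0 i.
    rewrite dfwith_in; congr tens; apply/funext => j.
    have [<-|ne] := eqVneq j0 j; first by rewrite !dfwith_in.
    by rewrite !dfwith_out// xpair_eqE eqxx.
  rewrite [RHS]dfwith_out//; congr tens; apply/funext => j.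
  by rewrite dfwith_out// xpair_eqE (negbTE ne).
by rewrite !E !tens_multilinear.
Qed.

Lemma tflat_tens I J V (v : I -> J -> V) :
  tflat I J V (tens (fun i => tens (v i))) = tens (fun p => v p.1 p.2).
Proof.
rewrite tlift_tens; last first.
  move=> w i a x y; apply: tpowP => h; rewrite tcoefD !mktpowE.
  rewrite !(bigD1 i (P := xpredT))//= !dfwith_in tcoefD mulrDl -mulrA.
  by congr (_ * (_ * _) + _ * _); apply: eq_bigr => j ne;
    rewrite !dfwith_out// eq_sym.
apply: tpowP => h; rewrite mktpowE tensE.
under eq_bigr => i _ do rewrite tensE.
rewrite pair_bigA /=; apply: eq_bigr => -[i j] _ /=.
by rewrite ffunE.
Qed.

Lemma tdual_tens I V (alpha : I -> dual V) (v : I -> V) :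
  (tdual I V (tens alpha) : 'Hom(tpow I V, K^o)) (tens v) =
  \prod_i (alpha i : 'Hom(V, K^o)) (v i).
Proof.
rewrite tlift_tens; first by rewrite tlift_tens//; exact: prod_multilinear.
move=> w i a x y; apply: tlift_uniq => u.
rewrite add_lfunE scale_lfunE !tlift_tens; do ?exact: prod_multilinear.
rewrite !(bigD1 i (P := xpredT))//= !dfwith_in add_lfunE scale_lfunE.
rewrite mulrDl -scalerAl.
by congr (_ *: (_ * _) + _ * _); apply: eq_bigr => j ne;
  rewrite !dfwith_out// eq_sym.
Qed.

End TensorPower.

(* In characteristic 0 the symmetrization is a projection, and the pairing
   induced by polarization is perfect *)

Section Char0.
Variable K : numFieldType.
Implicit Types (I J : finType) (U V : vectType K).

Lemma taverageE k V t :
  taverage k V t = (k`!%:R)^-1 *: \sum_(s : 'S_k) treindex V s t.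
Proof. by rewrite scale_lfunE sum_lfunE. Qed.

Lemma treindex_comp I J (L : finType) V (s : J -> I) (r : L -> J) :
  bijective s -> bijective r ->
  forall t : tpow I V, treindex V r (treindex V s t) = treindex V (s \o r) t.
Proof.
move=> bs br t; rewrite -comp_lfunE; congr (fun_of_lfun _ t).
apply: tlift_uniq => v; rewrite comp_lfunE !treindex_tens//.
exact: bij_comp.
Qed.

Lemma perm_bij k (s : 'S_k) : bijective s.
Proof. by exists (s^-1)%g; [exact: permK | exact: permKV]. Qed.

Lemma symvP k V t :
  reflect (forall s : 'S_k, treindex V s t = t) (t \in symv k V).
Proof.
rewrite -[_ \in _]/(<[t]> <= _)%VS.
apply: (iffP subv_bigcapP) => H s; first by apply/fixedSpaceP/H.
by move=> _; apply/fixedSpaceP.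
Qed.

Lemma taverage_sym k V t : taverage k V t \in symv k V.
Proof.
apply/symvP => r; rewrite taverageE linearZ linear_sum; congr (_ *: _) => /=.
rewrite [RHS](reindex_inj (mulgI r))/=; apply: eq_bigr => s _.
rewrite treindex_comp; do ?exact: perm_bij.
congr (fun_of_lfun (treindex V _) t); by apply/funext => i; rewrite permM.
Qed.

Lemma taverage_id k V t : t \in symv k V -> taverage k V t = t.
Proof.
move/symvP => H; rewrite taverageE (eq_bigr (fun=> t))//.
rewrite sumr_const card_Sn -scaler_nat scalerA mulVf ?scale1r//.
by rewrite pnatr_eq0 -lt0n fact_gt0.
Qed.

Lemma vsval_symmetrize k V t : vsval (symmetrize k V t) = taverage k V t.
Proof. by rewrite comp_lfunE lfunE/= vsprojK// taverage_sym. Qed.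

Lemma symmetrize_id k V (x : Sym k V) : symmetrize k V (vsval x) = x.
Proof. by apply: val_inj; rewrite /= vsval_symmetrize taverage_id// subvsP. Qed.

Definition tpair I V (t : tpow I V) (a : tpow I (dual V)) : K :=
  (tdual I V a : 'Hom(tpow I V, K^o)) t.

Lemma tpair_tens I V (v : I -> V) (alpha : I -> dual V) :
  tpair (tens v) (tens alpha) = \prod_i (alpha i : 'Hom(V, K^o)) (v i).
Proof. exact: tdual_tens. Qed.

Lemma tpairZl I V c (t : tpow I V) a : tpair (c *: t) a = c * tpair t a.
Proof. by rewrite /tpair linearZ. Qed.

Lemma tpairZr I V c (t : tpow I V) a : tpair t (c *: a) = c * tpair t a.
Proof. by rewrite /tpair linearZ scale_lfunE. Qed.

Lemma tpair_suml I V (T : finType) (F : T -> tpow I V) a :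
  tpair (\sum_i F i) a = \sum_i tpair (F i) a.
Proof. by rewrite /tpair linear_sum. Qed.

Lemma tpair_sumr I V (T : finType) (t : tpow I V) (F : T -> tpow I (dual V)) :
  tpair t (\sum_i F i) = \sum_i tpair t (F i).
Proof. by rewrite /tpair linear_sum sum_lfunE. Qed.

(* The polarization formula for the pairing of x_1 ... x_k with alpha ^ k. *)
Lemma tpair_sym_power k V (x : 'I_k -> V) (alpha : dual V) :
  tpair (vsval (symmetrize k V (tens x))) (tens (fun=> alpha)) =
  \prod_i (alpha : 'Hom(V, K^o)) (x i).
Proof.
rewrite vsval_symmetrize taverageE tpairZl tpair_suml.
set c := RHS; rewrite (eq_bigr (fun=> c : K)) => [|s _].
  rewrite (@sumr_const K) card_Sn -(mulr_natl (c : K)).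
  apply: (@mulKf K).
  by rewrite pnatr_eq0 -lt0n fact_gt0.
rewrite treindex_tens; last exact: perm_bij.
rewrite tpair_tens.
by rewrite [RHS](reindex_inj (@perm_inj _ s)).
Qed.

(* f and g are transposes of each other for the pairing tpair. *)
Definition tadj I J V (f : 'Hom(tpow I V, tpow J V))
    (g : 'Hom(tpow J (dual V), tpow I (dual V))) : Prop :=
  forall t a, tpair (f t) a = tpair t (g a).

Lemma tadj_tens I J V (f : 'Hom(tpow I V, tpow J V))
    (g : 'Hom(tpow J (dual V), tpow I (dual V))) :
  (forall (v : I -> V) (alpha : J -> dual V),
     tpair (f (tens v)) (tens alpha) = tpair (tens v) (g (tens alpha))) ->
  tadj f g.
Proof.
move=> H t a.
have E : (transpose f \o tdual J V = tdual I V \o g)%VF.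
  apply: tlift_uniq => alpha; apply: tlift_uniq => v.
  by rewrite !comp_lfunE transposeE; exact: H.
have := congr1 (fun F : 'Hom(_, dual _) => (F a : 'Hom(_, K^o)) t) E.
by rewrite !comp_lfunE transposeE.
Qed.

Lemma tadj_comp I J (L : finType) V (f : 'Hom(tpow I V, tpow J V))
    (g : 'Hom(tpow J (dual V), tpow I (dual V))) (f' : 'Hom(tpow J V, tpow L V))
    (g' : 'Hom(tpow L (dual V), tpow J (dual V))) :
  @tadj I J V f g -> @tadj J L V f' g' -> tadj (f' \o f)%VF (g \o g')%VF.
Proof. by move=> H H' t a; rewrite !comp_lfunE H' H. Qed.

Lemma tadj_reindex I J V (s : J -> I) (s' : I -> J) :
  cancel s s' -> cancel s' s -> tadj (treindex V s) (treindex (dual V) s').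
Proof.
move=> sK s'K; apply: tadj_tens => v alpha.
rewrite !treindex_tens ?tpair_tens; [|by exists s|by exists s'].
rewrite (reindex s') /=; first by apply: eq_bigr => i _; rewrite s'K.
by exists s => i _.
Qed.

Lemma tadj_average k V : tadj (taverage k V) (taverage k (dual V)).
Proof.
move=> t a; rewrite !taverageE tpairZl tpairZr tpair_suml tpair_sumr.
congr (_ * _).
rewrite [RHS](reindex_inj invg_inj)/=; apply: eq_bigr => s _.
by apply: tadj_reindex; [exact: permK | exact: permKV].
Qed.

Lemma tsplitK I J V t : tflat I J V (tsplit I J V t) = t.
Proof.
rewrite -comp_lfunE -[RHS]id_lfunE; congr (fun_of_lfun _ t).
apply: tlift_uniq => v; rewrite comp_lfunE id_lfunE tsplit_tens.
by rewrite (tflat_tens (fun i j => v (i, j))); congr tens; apply/funext; case.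
Qed.

Lemma tens_of_tens_ext I J V U (F G : 'Hom(tpow I (tpow J V), U)) :
  (forall v : I -> J -> V, F (tens (fun i => tens (v i))) =
                           G (tens (fun i => tens (v i)))) -> F = G.
Proof.
move=> H; apply: tlift_uniq.
have mF (E : 'Hom(tpow I (tpow J V), U)) :
    multilinear (fun u : I -> tpow J V => E (tens u)).
  by move=> w i a x y; rewrite tens_multilinear linearP.
suff S (s : seq I) (u : I -> tpow J V) :
    (forall i, i \notin s -> exists v, u i = tens v) -> F (tens u) = G (tens u).
  by move=> u; apply: (S (enum I)) => i; rewrite mem_enum.
elim: s u => [|i s IH] u hu.
  have /choice[v hv] : forall i, exists v, u i = tens v by move=> i; exact: hu.
  by have := H v; rewrite (_ : u = fun i => tens (v i))//; apply/funext.
have L (E : 'Hom(tpow I (tpow J V), U)) :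
    linear (fun z => E (tens (dfwith u (i := i) z))).
  by move=> a x y; exact: mF.
rewrite -(dfwith_id u i) -(linfunE (L F)) -(linfunE (L G)).
congr (fun_of_lfun _ (u i)); apply: tlift_uniq => v.
rewrite !linfunE; [|exact: L|exact: L]; apply: IH => j.
case: dfwithP => [|j' ne] js; first by exists v.
by apply: hu; rewrite in_cons negb_or eq_sym ne js.
Qed.

Lemma tflatK I J V t : tsplit I J V (tflat I J V t) = t.
Proof.
rewrite -comp_lfunE -[RHS]id_lfunE; congr (fun_of_lfun _ t).
apply: tens_of_tens_ext => v; rewrite comp_lfunE id_lfunE.
by rewrite tflat_tens tsplit_tens.
Qed.

Lemma tmap_comp I U V V' (f : 'Hom(U, V)) (g : 'Hom(V, V')) t :
  tmap I g (tmap I f t) = tmap I (g \o f)%VF t.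
Proof.
rewrite -comp_lfunE; congr (fun_of_lfun _ t); apply: tlift_uniq => v.
rewrite comp_lfunE !tmap_tens; congr tens; apply/funext => i.
by rewrite comp_lfunE.
Qed.

Lemma tmap_id I V t : tmap I (\1%VF : 'End(V)) t = t.
Proof.
rewrite -[RHS]id_lfunE; congr (fun_of_lfun _ t); apply: tlift_uniq => v.
by rewrite tmap_tens id_lfunE; congr tens; apply/funext => i; rewrite id_lfunE.
Qed.

Lemma tmap_average k U V (f : 'Hom(U, V)) t :
  taverage k V (tmap 'I_k f t) = tmap 'I_k f (taverage k U t).
Proof.
rewrite !taverageE linearZ [in RHS]linear_sum /=; congr (_ *: _); apply: eq_bigr => s _.
rewrite -!comp_lfunE; congr (fun_of_lfun _ t); apply: tlift_uniq => v.
rewrite !comp_lfunE tmap_tens !treindex_tens; do ?exact: perm_bij.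
by rewrite tmap_tens.
Qed.

(* Symmetrization within the groups and of the ordering of the groups: a
   retraction of incl2. *)
Definition symmetrize2 (a b : nat) V :
    'Hom(tpow ('I_a * 'I_b)%type V, Sym a (Sym b V)) :=
  (symmetrize a (Sym b V) \o
     (tmap 'I_a (symmetrize b V) \o tsplit 'I_a 'I_b V))%VF.

Lemma symmetrize2E a b V t : symmetrize2 a b V t =
  symmetrize a (Sym b V) (tmap 'I_a (symmetrize b V) (tsplit 'I_a 'I_b V t)).
Proof.
rewrite /symmetrize2 comp_lfunE; congr (fun_of_lfun _ _); exact: comp_lfunE.
Qed.

Lemma incl2E a b V x : incl2 a b V x =
  tflat 'I_a 'I_b V (tmap 'I_a (linfun vsval) (vsval x)).
Proof. by rewrite !comp_lfunE (lfunE vsval). Qed.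

Lemma incl2K a b V x : symmetrize2 a b V (incl2 a b V x) = x.
Proof.
rewrite incl2E symmetrize2E tflatK tmap_comp.
have -> : (symmetrize b V \o linfun vsval = \1)%VF.
  by apply/lfunP => y; rewrite comp_lfunE id_lfunE (lfunE vsval) symmetrize_id.
by rewrite tmap_id symmetrize_id.
Qed.

Definition average2 (a b : nat) V : 'End(tpow ('I_a * 'I_b)%type V) :=
  (tflat 'I_a 'I_b V \o (taverage a (tpow 'I_b V) \o
     (tmap 'I_a (taverage b V) \o tsplit 'I_a 'I_b V)))%VF.

Lemma symmetrize2K a b V t :
  incl2 a b V (symmetrize2 a b V t) = average2 a b V t.
Proof.
rewrite incl2E symmetrize2E vsval_symmetrize /average2; do 3!rewrite comp_lfunE.
rewrite -tmap_average tmap_comp.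
have -> : (linfun vsval \o symmetrize b V)%VF = taverage b V.
  apply/lfunP => u; rewrite comp_lfunE -vsval_symmetrize; exact: (lfunE vsval).
by rewrite tmap_average.
Qed.

Lemma tpair_flat I J V (u : I -> tpow J V) (w : I -> tpow J (dual V)) :
  tpair (tflat I J V (tens u)) (tflat I J (dual V) (tens w)) =
  \prod_i tpair (u i) (w i).
Proof.
pose D := (transpose (tflat I J V) \o
            (tdual (I * J)%type V \o tflat I J (dual V)))%VF.
pose E := (tdual I (tpow J V) \o tmap I (tdual J V))%VF.
have DE : D = E.
  apply: tens_of_tens_ext => alpha; apply: tens_of_tens_ext => v.
  rewrite /D /E; do 3!rewrite comp_lfunE; rewrite transposeE !tflat_tens.
  rewrite tmap_tens !tdual_tens.
  rewrite -(pair_bigA _ (fun i j => (alpha i j : 'Hom(V, K^o)) (v i j)))/=.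
  by apply: eq_bigr => i _; rewrite tdual_tens.
have := congr1 (fun F : 'Hom(_, dual _) => (F (tens w) : 'Hom(_, K^o)) (tens u)) DE.
rewrite /D /E; do 3!rewrite comp_lfunE.
by rewrite transposeE tmap_tens tdual_tens.
Qed.

Lemma tadj_flat I J V (f : 'End(tpow I (tpow J V)))
    (g : 'End(tpow I (tpow J (dual V)))) :
  (forall (v : I -> J -> V) (alpha : I -> J -> dual V),
    tpair (tflat I J V (f (tens (fun i => tens (v i)))))
      (tflat I J (dual V) (tens (fun i => tens (alpha i)))) =
    tpair (tflat I J V (tens (fun i => tens (v i))))
      (tflat I J (dual V) (g (tens (fun i => tens (alpha i)))))) ->
  tadj (tflat I J V \o (f \o tsplit I J V))%VF
    (tflat I J (dual V) \o (g \o tsplit I J (dual V)))%VF.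
Proof.
move=> H; apply: tadj_tens => v alpha.
do 4!rewrite comp_lfunE; rewrite !tsplit_tens.
rewrite -(tsplitK (tens alpha)) -(tsplitK (tens v)) !tsplit_tens.
exact: (H (fun i j => v (i, j)) (fun i j => alpha (i, j))).
Qed.

Lemma tadj_average2 a b V : tadj (average2 a b V) (average2 a b (dual V)).
Proof.
have A1 : tadj
    (tflat 'I_a 'I_b V \o (taverage a (tpow 'I_b V) \o tsplit 'I_a 'I_b V))%VF
    (tflat 'I_a 'I_b (dual V) \o
      (taverage a (tpow 'I_b (dual V)) \o tsplit 'I_a 'I_b (dual V)))%VF.
  apply: tadj_flat => v alpha; rewrite !taverageE !linearZ !(linear_sum (tflat _ _ _)).
  rewrite /= tpairZl tpairZr tpair_suml tpair_sumr; congr (_ * _).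
  rewrite [RHS](reindex_inj invg_inj)/=; apply: eq_bigr => s _.
  rewrite !treindex_tens; do ?exact: perm_bij.
  rewrite !tpair_flat (reindex_inj (@perm_inj _ s^-1%g))/=.
  by apply: eq_bigr => i _; rewrite permKV.
have A2 : tadj
    (tflat 'I_a 'I_b V \o (tmap 'I_a (taverage b V) \o tsplit 'I_a 'I_b V))%VF
    (tflat 'I_a 'I_b (dual V) \o
      (tmap 'I_a (taverage b (dual V)) \o tsplit 'I_a 'I_b (dual V)))%VF.
  apply: tadj_flat => v alpha; rewrite !tmap_tens !tpair_flat.
  by apply: eq_bigr => i _; exact: tadj_average.
move=> t x; have := tadj_comp A2 A1 t x.
rewrite /average2; do ![rewrite comp_lfunE]; rewrite !tflatK.
by rewrite !tmap_average.
Qed.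

(* The pairing on tensor powers is perfect. *)
Lemma tdual_surj I V (phi : dual (tpow I V)) : exists a, tdual I V a = phi.
Proof.
pose c k : dual V := linfun (coord (vbasis {:V}) k : V -> K^o).
exists (\sum_(g : {ffun I -> 'I_(\dim {:V})})
  (phi : 'Hom(tpow I V, K^o)) (tens (fun i => (vbasis {:V})`_(g i)))
  *: tens (fun i => c (g i))).
apply/lfunP => t; have -> : t = \sum_(g : {ffun I -> 'I_(\dim {:V})})
    tcoef t g *: tens (fun i => (vbasis {:V})`_(g i)).
  by rewrite -[LHS]id_lfunE -tliftE; congr (fun_of_lfun _ t);
    apply: tlift_uniq => v; rewrite id_lfunE tlift_tens//; exact: tens_multilinear.
rewrite !linear_sum; apply: eq_bigr => h _; rewrite !linearZ; congr (_ *: _) => /=.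
rewrite sum_lfunE (bigD1 h)//= big1 => [|g ne]; rewrite linearZ scale_lfunE tdual_tens.
  rewrite addr0 big1 ?mulr1 => [|i _]; first exact: mulr1.
  by rewrite lfunE /= coord_e eqxx.
have [i nei] : exists i, g i != h i.
  apply/existsP; apply: contraNT ne; rewrite negb_exists => /forallP e.
  by apply/eqP/ffunP => i; apply/eqP; have := e i; rewrite negbK.
by rewrite (bigD1 i)//= lfunE /= coord_e (negbTE nei) mul0r scaler0.
Qed.

Lemma dimv_dual V : \dim {:dual V} = \dim {:V}.
Proof. by rewrite !dimvf /dim /= muln1. Qed.

Lemma tdual_inj I V : injective (tdual I V).
Proof.
apply/lker0P; rewrite -dimv_eq0.
have /eqP := limg_ker_dim (tdual I V) fullv.
have -> : limg (tdual I V) = fullv.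
  apply/vspaceP => phi; rewrite memvf; have [a <-] := tdual_surj phi.
  by rewrite memv_img ?memvf.
rewrite capfv dimv_dual.
have -> : \dim {:tpow I (dual V)} = \dim {:tpow I V}.
  by rewrite !dimvf /dim /= !muln1 !card_ffun !card_ord dimv_dual.
by rewrite -[X in _ == X]add0n eqn_add2r.
Qed.

Lemma sym2_dualE a b V Q P :
  (sym2_dual a b V Q : 'Hom(_, K^o)) P =
  tpair (incl2 a b V P) (incl2 a b (dual V) Q).
Proof.
rewrite /sym2_dual comp_lfunE transposeE /tpair.
by congr (fun_of_lfun _ _); exact: comp_lfunE.
Qed.

Lemma sym2_dual_bij a b V : bijective (sym2_dual a b V).
Proof.
have avK U y : average2 a b U (incl2 a b U y) = incl2 a b U y.
  by rewrite -symmetrize2K incl2K.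
have inj : injective (sym2_dual a b V).
  apply: raddf_inj => Q Q0.
  rewrite -[Q]incl2K; suff -> : incl2 a b (dual V) Q = 0 by rewrite linear0.
  apply: (@tdual_inj _ V); rewrite linear0; apply/lfunP => t.
  rewrite zero_lfunE -[LHS]/(tpair _ _) -avK -tadj_average2 -symmetrize2K.
  by rewrite -sym2_dualE Q0 zero_lfunE.
have surj phi : exists Q, sym2_dual a b V Q = phi.
  have [x xE] := tdual_surj (transpose (symmetrize2 a b V) phi).
  exists (symmetrize2 a b (dual V) x); apply/lfunP => P.
  rewrite sym2_dualE symmetrize2K -tadj_average2 avK /tpair xE transposeE.
  by rewrite incl2K.
have /choice[h hK] := surj.
by exists h => // Q; apply: inj; rewrite hK.
Qed.

End Char0.

(* Main.v *)
Require Import Defs.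
From mathcomp Require Import all_boot all_algebra reals complex.
Local Open Scope ring_scope.

(** The Foulkes-Howe map is the inclusion [incl2] into the tensor power, followed
    by the exchange of the two factor labels and by [symmetrize2]. Exchanging the
    labels is adjoint to exchanging them back, and [symmetrize2] followed by [incl2]
    is the self-adjoint projection [average2], which fixes the image of [incl2].
    Hence both sides, evaluated at [P], equal the pairing of [incl2 Q] with the
    regrouped [incl2 P]. *)

(** Isolates the exchange of labels, so that [symmetrize2K] can turn the remaining symmetrizations
    into [average2]. *)
Lemma foulkes_howeE (K : numFieldType) (delta d : nat) (V : vectType K)
    (P : Sym delta (Sym d V)) :
  foulkes_howe delta d V P =
  symmetrize2 d delta V
    (treindex V (fun p : 'I_d * 'I_delta => (p.2, p.1)) (incl2 delta d V P)).
Proof.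
rewrite symmetrize2E; do 3![rewrite [LHS]comp_lfunE; congr (fun_of_lfun _ _)].
exact: comp_lfunE.
Qed.

Lemma average2_incl2 (K : numFieldType) (a b : nat) (V : vectType K)
    (P : Sym a (Sym b V)) :
  average2 a b V (incl2 a b V P) = incl2 a b V P.
Proof. by rewrite -symmetrize2K incl2K. Qed.

Lemma foulkes_howe_self_dual (K : numFieldType) (V : vectType K) (d delta : nat)
    (Q : Sym d (Sym delta (dual V))) :
  transpose (foulkes_howe delta d V) (sym2_dual d delta V Q) =
  sym2_dual delta d V (foulkes_howe d delta (dual V) Q).
Proof.
apply/lfunP => P; rewrite transposeE !sym2_dualE !foulkes_howeE !symmetrize2K.
(* On each side the average moves across the pairing onto the argument that lies in the image of
   [incl2], and is absorbed there. *)
rewrite tadj_average2 -[in RHS]tadj_average2 !average2_incl2.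
(* The exchanges on [V] and on [dual V] are mutually inverse relabelings; [case] checks this on
   pairs. *)
by apply: tadj_reindex; case.
Qed.

Theorem proposition1p10 (R : realType) (W : vectType R[i]) (d delta : nat)
    (hd : (0 < d)%N) (hdelta : (0 < delta)%N) :
  forall Q : Sym d (Sym delta (dual W)),
    transpose (foulkes_howe delta d W) (sym2_dual d delta W Q) =
    sym2_dual delta d W (foulkes_howe d delta (dual W) Q).
Proof. exact: foulkes_howe_self_dual. Qed.
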